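(* Let $K$ be a field and $R=K[x_{12},x_{13},x_{23},y_1,y_2,y_3]$ a polynomial ring. Put $g_{13}=x_{12}y_2+x_{13}y_3$, $g_{23}=-x_{12}y_1+x_{23}y_3$, $g_{33}=-x_{13}y_1-x_{23}y_2$, and let $I_3=\langle g_{13},g_{23}\rangle$ and $J_3=\langle g_{33}\rangle$. Then $(I_3:J_3)=\langle x_{12},y_3\rangle$.
   Context: The polynomials $g_{13},g_{23},g_{33}$ are the entries of $X_3Y_3$, where $X_3=\begin{pmatrix}0&x_{12}&x_{13}\\-x_{12}&0&x_{23}\\-x_{13}&-x_{23}&0\end{pmatrix}$ is the generic skew-symmetric $3\times 3$ matrix and $Y_3=(y_1,y_2,y_3)^T$. The colon ideal is $(I:J)=\{p\in R: pJ\subseteq I\}$. *)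

(* Defs.v *)
From HB Require Import structures.
From mathcomp Require Import all_boot all_order all_algebra mpoly.

Set Implicit Arguments.
Unset Strict Implicit.
Unset Printing Implicit Defensive.

Import GRing.Theory.
Local Open Scope ring_scope.

(* Ideals are Prop-valued predicates: the ideal structures of MathComp's
   ring_quotient cover only proper ideals given by boolean predicates. *)
Definition ideal_gen (R : comNzRingType) (s : seq R) (p : R) : Prop :=
  exists c : 'I_(size s) -> R, p = \sum_(i < size s) c i * s`_i.

Definition colon_ideal (R : comNzRingType) (I J : R -> Prop) (p : R) : Prop :=
  forall q : R, J q -> I (p * q).

Section Polynomials.

Variable K : fieldType.

Definition x12 : {mpoly K[6]} := 'X_(@Ordinal 6 0 isT).
Definition x13 : {mpoly K[6]} := 'X_(@Ordinal 6 1 isT).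
Definition x23 : {mpoly K[6]} := 'X_(@Ordinal 6 2 isT).
Definition y1 : {mpoly K[6]} := 'X_(@Ordinal 6 3 isT).
Definition y2 : {mpoly K[6]} := 'X_(@Ordinal 6 4 isT).
Definition y3 : {mpoly K[6]} := 'X_(@Ordinal 6 5 isT).

(* The entries, from top to bottom, of the product of the generic
   skew-symmetric matrix (0, x12, x13; -x12, 0, x23; -x13, -x23, 0)
   with the column (y1, y2, y3). *)
Definition g13 : {mpoly K[6]} := x12 * y2 + x13 * y3.
Definition g23 : {mpoly K[6]} := - x12 * y1 + x23 * y3.
Definition g33 : {mpoly K[6]} := - x13 * y1 - x23 * y2.

Definition I3 : {mpoly K[6]} -> Prop := ideal_gen [:: g13; g23].
Definition J3 : {mpoly K[6]} -> Prop := ideal_gen [:: g33].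

End Polynomials.

Arguments I3 K p : clear implicits.
Arguments J3 K p : clear implicits.

(* Main.v *)
(** Both generators of the right-hand ideal multiply [g33] into [I3] by an
    explicit syzygy.  Conversely, setting [x12 = y3 = 0] is a ring morphism
    that kills [I3] and fixes the nonzero polynomial [g33], so it kills every
    element of the colon ideal; and its kernel is [(x12, y3)]. *)
Require Import Defs.
From mathcomp Require Import all_boot all_order all_algebra mpoly.
From mathcomp Require Import ring.

Set Implicit Arguments.
Unset Strict Implicit.
Unset Printing Implicit Defensive.

Import GRing.Theory.
Local Open Scope ring_scope.

Lemma ideal_gen1P (R : comNzRingType) (a p : R) :
  ideal_gen [:: a] p <-> exists u, p = u * a.
Proof.
split=> [[c ->]|[u ->]].
  by exists (c ord0); rewrite big_ord1.
by exists (fun=> u); rewrite big_ord1.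
Qed.

Lemma ideal_gen2P (R : comNzRingType) (a b p : R) :
  ideal_gen [:: a; b] p <-> exists u v, p = u * a + v * b.
Proof.
split=> [[c ->]|[u [v ->]]].
  by exists (c ord0), (c (lift ord0 ord0)); rewrite big_ord_recl big_ord1.
exists (fun i => if i == ord0 then u else v).
by rewrite big_ord_recl big_ord1.
Qed.

Section Ideal.

Variables (R : comNzRingType) (s : seq R).

Lemma ideal_gen0 : ideal_gen s 0.
Proof. by exists (fun=> 0); rewrite big1 // => i _; rewrite mul0r. Qed.

Lemma ideal_genD p q : ideal_gen s p -> ideal_gen s q -> ideal_gen s (p + q).
Proof.
move=> [c ->] [d ->]; exists (fun i => c i + d i).
by rewrite -big_split; apply: eq_bigr => i _; rewrite mulrDl.
Qed.

Lemma ideal_genMl a p : ideal_gen s p -> ideal_gen s (a * p).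
Proof.
move=> [c ->]; exists (fun i => a * c i).
by rewrite mulr_sumr; apply: eq_bigr => i _; rewrite mulrA.
Qed.

Lemma mem_ideal_gen a : a \in s -> ideal_gen s a.
Proof.
move=> sa; have lt_as : (index a s < size s)%N by rewrite index_mem.
exists (fun i => (i == Ordinal lt_as)%:R).
rewrite (bigD1 (Ordinal lt_as)) //= eqxx mul1r nth_index // big1 ?addr0 //.
by move=> i /negPf->; rewrite mul0r.
Qed.

Lemma ideal_gen_subM a b c d :
  ideal_gen s (a - b) -> ideal_gen s (c - d) -> ideal_gen s (a * c - b * d).
Proof.
move=> sab scd.
have -> : a * c - b * d = c * (a - b) + b * (c - d) by ring.
by apply: ideal_genD; apply: ideal_genMl.
Qed.

End Ideal.

(** Congruence modulo an ideal respects sums and products, so it passes from the variables to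
    powers, then to monomials, then to all polynomials. *)
Lemma ideal_gen_sub_comp_mpoly (R : comNzRingType) n
    (s : seq {mpoly R[n]}) (t : n.-tuple {mpoly R[n]}) (p : {mpoly R[n]}) :
  (forall i, ideal_gen s ('X_i - tnth t i)) -> ideal_gen s (p - (p \mPo t)).
Proof.
move=> st; elim/mpolyind: p => [|c m p _ _ IHp].
  by rewrite comp_mpoly0 subrr; apply: ideal_gen0.
rewrite comp_mpolyD opprD addrACA; apply: ideal_genD => //.
rewrite comp_mpolyZ -scalerBr -mul_mpolyC; apply: ideal_genMl.
(* Both monomials become products over the same indices and are compared factor by factor. *)
rewrite comp_mpolyX [X in X - _]mpolyXE_id.
elim/big_rec2: _ => [|i q q' _ IHq]; first by rewrite subrr; apply: ideal_gen0.
apply: ideal_gen_subM => //.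
elim: (m i) => [|k IHk]; first by rewrite !expr0 subrr; apply: ideal_gen0.
by rewrite !exprS; apply: ideal_gen_subM.
Qed.

Section Specialization.

Variable K : fieldType.

Let t : 6.-tuple {mpoly K[6]} := [tuple 0; x13 K; x23 K; y1 K; y2 K; 0].

Lemma g33_neq0 : g33 K != 0.
Proof.
(* The point [x13 = y1 = 1] with all other coordinates [0], where [g33] takes the value [-1]. *)
pose v (i : 'I_6) : K := ((i == 1%N :> nat) || (i == 3 :> nat))%:R.
apply/eqP => /(congr1 (meval v)); apply/eqP.
rewrite /g33 /x13 /x23 /y1 /y2 mevalB mevalM mevalN mevalM !mevalXU meval0 /v /=.
by rewrite mulr0 subr0 mulr1 oppr_eq0 oner_eq0.
Qed.

(** This gives the kernel: a polynomial that specializes to [0] lies in the ideal of [x12] and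
    [y3]. *)
Lemma ideal_gen_sub_specialization p :
  ideal_gen [:: x12 K; y3 K] (p - (p \mPo t)).
Proof.
apply: ideal_gen_sub_comp_mpoly => -[[|[|[|[|[|[|i]]]]]] lt_i6] //;
  rewrite (bool_irrelevance lt_i6 isT) (tnth_nth 0) /=.
- by rewrite subr0; apply/mem_ideal_gen/mem_head.
- by rewrite subrr; apply: ideal_gen0.
- by rewrite subrr; apply: ideal_gen0.
- by rewrite subrr; apply: ideal_gen0.
- by rewrite subrr; apply: ideal_gen0.
- by rewrite subr0; apply: mem_ideal_gen; rewrite !inE eqxx orbT.
Qed.

Lemma specialization_g13 : g13 K \mPo t = 0.
Proof.
rewrite /g13 /x12 /x13 /y3 rmorphD !rmorphM /= !comp_mpolyXU /=.
by rewrite mul0r mulr0 addr0.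
Qed.

Lemma specialization_g23 : g23 K \mPo t = 0.
Proof.
rewrite /g23 /x12 /x23 /y3 rmorphD !rmorphM rmorphN /= !comp_mpolyXU /=.
by rewrite oppr0 mul0r mulr0 addr0.
Qed.

Lemma specialization_g33 : g33 K \mPo t = g33 K.
Proof.
by rewrite [in LHS]/g33 rmorphB !rmorphM rmorphN /= !comp_mpolyXU.
Qed.

(** Specializing [p * g33 = c0 * g13 + c1 * g23] leaves [(p \mPo t) * g33 = 0], and the polynomial
    ring is a domain. *)
Lemma specialization_colon p : colon_ideal (I3 K) (J3 K) p -> p \mPo t = 0.
Proof.
move=> /(_ (g33 K)) []; first exact/mem_ideal_gen/mem_head.
move=> c /(congr1 (comp_mpoly t)) /eqP.
rewrite big_ord_recl big_ord1 /= rmorphD !rmorphM /=.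
rewrite specialization_g13 specialization_g23 specialization_g33 !mulr0 addr0.
by rewrite mulf_eq0 (negPf g33_neq0) orbF => /eqP.
Qed.

End Specialization.

Theorem mainTheorem1 (K : fieldType) (p : {mpoly K[6]}) :
  colon_ideal (I3 K) (J3 K) p <-> ideal_gen [:: x12 K; y3 K] p.
Proof.
split=> [colon_p | /ideal_gen2P[u [v ->]] q /ideal_gen1P[w ->]].
  have := ideal_gen_sub_specialization p.
  by rewrite specialization_colon // subr0.
apply/ideal_gen2P.
(* The syzygies are [x12 * g33 = - x23 * g13 + x13 * g23], as the row [(x23, -x13, x12)] annihilates
   the skew-symmetric matrix, and [y3 * g33 = - y1 * g13 - y2 * g23], as its quadratic form vanishes
   on [(y1, y2, y3)]. They are combined with weights [w * u] and [w * v]. *)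
exists (w * (- u * x23 K - v * y1 K)), (w * (u * x13 K - v * y2 K)).
by rewrite /g13 /g23 /g33; ring.
Qed.
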